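(* Let $\boldsymbol{\pi}\in\mathbb{R}^n$ be a vector with positive entries such that $\boldsymbol{\pi}^T\mathbf{1}=1$, let $f:\mathbb{S}_n^{\boldsymbol{\pi}}\to\mathbb{R}$ be a smooth function, let $S\in\mathbb{S}_n^{\boldsymbol{\pi}}$ and $\xi_S\in\mathcal{T}_S\mathbb{S}_n^{\boldsymbol{\pi}}$. The Riemannian Hessian $\operatorname{hess} f(S)[\xi_S]$, with respect to the Fisher metric, can be obtained from the Euclidean gradient $\operatorname{Grad} f(S)$ and the Euclidean Hessian $\operatorname{Hess} f(S)$ by the identity $$\operatorname{hess} f(S)[\xi_S] = \Pi_S\big(\mathrm{D}(\operatorname{grad} f(S))[\xi_S]\big)-\tfrac12\, \Pi_S\Big(\big( \Pi_S(\operatorname{Grad} f(S)\odot S) \odot \xi_S\big) \oslash S\Big),$$ where $$\mathrm{D}(\operatorname{grad} f(S))[\xi_S] = \dot{\gamma}[\xi_S]- \big(\dot{\boldsymbol{\alpha}}[\xi_S] \mathbf{1}^T+\boldsymbol{\pi}\,\dot{\boldsymbol{\beta}}[\xi_S]^T\big)\odot S -(\boldsymbol{\alpha} \mathbf{1}^T+\boldsymbol{\pi}\boldsymbol{\beta}^T)\odot \xi_S,$$ and $$\gamma = \operatorname{Grad} f(S)\odot S,\qquad \dot{\gamma}[\xi_S] = \operatorname{Hess} f(S)[\xi_S]\odot S + \operatorname{Grad} f(S)\odot \xi_S,$$ $$\mathcal{A} = \begin{bmatrix} I & D_{\boldsymbol{\pi}} S \\ S^T D_{\boldsymbol{\pi}}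 & \mathrm{diag}( S^TD_{\boldsymbol{\pi}}\boldsymbol{\pi})\end{bmatrix},$$ $\boldsymbol{\alpha},\boldsymbol{\beta}\in\mathbb{R}^n$ are such that $$\mathcal{A} \begin{bmatrix}\boldsymbol{\alpha} \\ \boldsymbol{\beta}\end{bmatrix} = \begin{bmatrix}\gamma \mathbf{1} \\ \gamma^T \boldsymbol{\pi}\end{bmatrix},$$ and $\dot{\boldsymbol{\alpha}}[\xi_S],\dot{\boldsymbol{\beta}}[\xi_S]\in\mathbb{R}^n$ are such that $$\mathcal{A} \begin{bmatrix}\dot{\boldsymbol{\alpha}}[\xi_S] \\ \dot{\boldsymbol{\beta}}[\xi_S]\end{bmatrix} = \begin{bmatrix}\dot{\gamma}[\xi_S] \mathbf{1} \\ \dot{\gamma}[\xi_S]^T \boldsymbol{\pi}\end{bmatrix} -\begin{bmatrix}0 & D_{\boldsymbol{\pi}} \xi_S \\ \xi_S^T D_{\boldsymbol{\pi}} & \mathrm{diag}(\xi_ S^TD_{\boldsymbol{\pi}}\boldsymbol{\pi})\end{bmatrix} \begin{bmatrix}\boldsymbol{\alpha} \\ \boldsymbol{\beta}\end{bmatrix}.$$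
   Context: $\mathbf{1}=(1,\ldots,1)^T\in\mathbb{R}^n$; $\odot$ and $\oslash$ denote entrywise (Hadamard) multiplication and division; for a vector $\mathbf{x}$, $\operatorname{diag}(\mathbf{x})$ is the diagonal matrix with the entries of $\mathbf{x}$ on the diagonal, and $D_{\boldsymbol{\pi}}=\operatorname{diag}(\boldsymbol{\pi})$; $S>0$ means all entries are positive. $\mathbb{S}_n^{\boldsymbol{\pi}} = \{ S \in \mathbb{R}^{n \times n} : S \mathbf{1} = \mathbf{1},\ \boldsymbol{\pi}^T S = \boldsymbol{\pi}^T,\ S > 0 \}$ is an embedded submanifold of $\mathbb{R}^{n\times n}$ whose tangent space at $S$ is $\mathcal{T}_S \mathbb{S}_n^{\boldsymbol{\pi}} = \{ \xi \in \mathbb{R}^{n \times n} : \xi \mathbf{1} = \mathbf{0},\ \boldsymbol{\pi}^T \xi = \mathbf{0}^T \}$. It is endowed with the Fisher metric $\langle \xi,\eta\rangle_S=\sum_{i,j=1}^n \frac{\xi_{i,j}\eta_{i,j}}{S_{i,j}}$, a formula which defines an inner product on all of $\mathbb{R}^{n\times n}$; $\Pi_S:\mathbb{R}^{n\times n}\to\mathcal{T}_S\mathbb{S}_n^{\boldsymbol{\pi}}$ is the orthogonal projection with respect to $\langle\cdot,\cdot\rangle_S$. The function $f$ is understood as (extended to) a smooth function on an open neighborhood of $\mathbb{S}_n^{\boldsymbol{\pi}}$ in $\mathbb{R}^{n\times n}$; $\operatorname{Grad} f(S)\in\mathbb{R}^{n\times n}$ is its gradient with respect to the Euclidean inner product $\operatorname{Trace}(XY^T)$,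 and $\operatorname{Hess}f(S)[\xi]=\mathrm{D}(\operatorname{Grad}f(S))[\xi]$ is the directional derivative of $\operatorname{Grad}f$ at $S$ along $\xi$. The Riemannian gradient $\operatorname{grad}f(S)$ is the unique vector in $\mathcal{T}_S\mathbb{S}_n^{\boldsymbol{\pi}}$ with $\langle\operatorname{grad}f(S),\xi_S\rangle_S=\mathrm{D}f(S)[\xi_S]$ for all $\xi_S\in\mathcal{T}_S\mathbb{S}_n^{\boldsymbol{\pi}}$, and $\mathrm{D}(\operatorname{grad}f(S))[\xi_S]$ is the directional derivative at $S$ along $\xi_S$ of $S\mapsto\operatorname{grad}f(S)$ regarded as a matrix-valued map. The Riemannian Hessian is $\operatorname{hess}f(S)[\xi_S]=\nabla_{\xi_S}\operatorname{grad}f(S)$ for $\xi_S\in\mathcal{T}_S\mathbb{S}_n^{\boldsymbol{\pi}}$, where $\nabla$ is the Levi-Civita connection of $\mathbb{S}_n^{\boldsymbol{\pi}}$ with the Fisher metric. *)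

(* Defs.v *)
From HB Require Import structures.
From mathcomp Require Import all_boot all_order all_algebra.
From mathcomp Require Import all_classical all_reals all_analysis.

Set Implicit Arguments.
Unset Strict Implicit.
Unset Printing Implicit Defensive.

Import Order.TTheory GRing.Theory Num.Theory.
Import numFieldNormedType.Exports.

Local Open Scope classical_set_scope.
Local Open Scope ring_scope.

Section Smoothness.
Context {R : realType} {V W : normedModType R}.

(* [F] is [C^k] on [A].  Meant for [A] open and [V] finite-dimensional, where
   [x |-> 'd F x] is [C^k] iff [x |-> 'd F x v = 'D_v F x] is, for each [v]. *)
Fixpoint Ck (k : nat) (A : set V) (F : V -> W) : Prop :=
  if k is k'.+1 then
    (forall x, A x -> differentiable F x) /\
    (forall v, Ck k' A (fun x => 'D_v F x))
  else forall x, A x -> {for x, continuous F}.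

Definition smooth_on (A : set V) (F : V -> W) : Prop := forall k, Ck k A F.

(* Smoothness of a map on an embedded submanifold [M], represented by a total
   function whose values outside [M] are irrelevant. *)
Definition smooth_on_submanifold (M : set V) (F : V -> W) : Prop :=
  exists (A : set V) (Fext : V -> W),
    [/\ open A, M `<=` A, smooth_on A Fext & forall x, M x -> Fext x = F x].

End Smoothness.

Section Hadamard.
Context {R : realType} {m n : nat}.

Definition hmul (A B : 'M[R]_(m, n)) : 'M[R]_(m, n) :=
  map2_mx (fun a b : R => a * b) A B.

Definition hdiv (A B : 'M[R]_(m, n)) : 'M[R]_(m, n) :=
  map2_mx (fun a b : R => a / b) A B.

End Hadamard.

Notation "A ⊙ B" := (hmul A B) (at level 40, left associativity) : ring_scope.
Notation "A ⊘ B" := (hdiv A B) (at level 40, left associativity) : ring_scope.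

Section FisherManifold.
Context {R : realType} {n : nat}.
Implicit Types (pi : 'cV[R]_n) (S X Y xi : 'M[R]_n) (f : 'M[R]_n -> R).

Definition ones : 'cV[R]_n := const_mx 1.

Definition diagc (x : 'cV[R]_n) : 'M[R]_n := diag_mx x^T.

Definition stoch pi : set 'M[R]_n :=
  [set S | [/\ S *m ones = ones, pi^T *m S = pi^T & forall i j, 0 < S i j]].

(* The tangent space does not depend on the base point. *)
Definition tangent pi : set 'M[R]_n :=
  [set xi | xi *m ones = 0 /\ pi^T *m xi = 0].

Definition frob X Y : R := \tr (X *m Y^T).

Definition fisher S X Y : R := \sum_i \sum_j X i j * Y i j / S i j.

Definition is_gradient (ip : 'M[R]_n -> 'M[R]_n -> R) (T : set 'M[R]_n) f S :
    set 'M[R]_n :=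
  [set G | T G /\ forall xi, T xi -> ip G xi = 'D_xi f S].

Definition Egrad f S : 'M[R]_n := xget 0 (is_gradient frob setT f S).

Definition Ehess f S xi : 'M[R]_n := 'D_xi (Egrad f) S.

Definition Rgrad pi f S : 'M[R]_n :=
  xget 0 (is_gradient (fisher S) (tangent pi) f S).

Definition tproj pi S X : 'M[R]_n :=
  xget 0 [set P | tangent pi P /\
                  forall xi, tangent pi xi -> fisher S (X - P) xi = 0].

Definition smooth_field pi (V : 'M[R]_n -> 'M[R]_n) : Prop :=
  (forall S, stoch pi S -> tangent pi (V S)) /\
  smooth_on_submanifold (stoch pi) V.

(* [nabla S xi V] is the covariant derivative of the vector field [V] at the
   point [S] along the tangent vector [xi].  Derivatives along tangent vectors
   are taken in the ambient space; [stoch pi] is relatively open in an affine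
   subspace of direction [tangent pi], so at a point of [stoch pi] they only
   depend on the values on [stoch pi]. *)
Record affine_connection pi
    (nabla : 'M[R]_n -> 'M[R]_n -> ('M[R]_n -> 'M[R]_n) -> 'M[R]_n) : Prop := {
  connection_field : forall U V, smooth_field pi U -> smooth_field pi V ->
    smooth_field pi (fun S => nabla S (U S) V);
  connection_linearl : forall S (a : R) xi eta V,
    stoch pi S -> tangent pi xi -> tangent pi eta -> smooth_field pi V ->
    nabla S (a *: xi + eta) V = a *: nabla S xi V + nabla S eta V;
  connection_linearr : forall S xi (a : R) U V,
    stoch pi S -> tangent pi xi -> smooth_field pi U -> smooth_field pi V ->
    nabla S xi (fun Z => a *: U Z + V Z) = a *: nabla S xi U + nabla S xi V;
  connection_leibniz : forall S xi (h : 'M[R]_n -> R) V,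
    stoch pi S -> tangent pi xi ->
    smooth_on_submanifold (stoch pi) h -> smooth_field pi V ->
    nabla S xi (fun Z => h Z *: V Z) =
      'D_xi h S *: V S + h S *: nabla S xi V
}.

Record levi_civita pi
    (nabla : 'M[R]_n -> 'M[R]_n -> ('M[R]_n -> 'M[R]_n) -> 'M[R]_n) : Prop := {
  levi_civita_connection : affine_connection pi nabla;
  levi_civita_torsion_free : forall S U V,
    stoch pi S -> smooth_field pi U -> smooth_field pi V ->
    nabla S (U S) V - nabla S (V S) U = 'D_(U S) V S - 'D_(V S) U S;
  levi_civita_metric : forall S xi U V,
    stoch pi S -> tangent pi xi -> smooth_field pi U -> smooth_field pi V ->
    'D_xi (fun Z => fisher Z (U Z) (V Z)) S =
      fisher S (nabla S xi U) (V S) + fisher S (U S) (nabla S xi V)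
}.

Definition Rhess pi
    (nabla : 'M[R]_n -> 'M[R]_n -> ('M[R]_n -> 'M[R]_n) -> 'M[R]_n)
    f S xi : 'M[R]_n :=
  nabla S xi (Rgrad pi f).

End FisherManifold.

(* Main.v *)
Require Import Defs.
From HB Require Import structures.
From mathcomp Require Import all_boot all_order all_algebra.
From mathcomp Require Import all_classical all_reals all_analysis.
From mathcomp Require Import ring lra.
Import Order.TTheory GRing.Theory Num.Theory.
Import numFieldNormedType.Exports.
Local Open Scope classical_set_scope.
Local Open Scope ring_scope.

(** On the open set of matrices with positive entries, the Fisher metric [fisher S]
is an inner product, and the orthogonal complement of the tangent space consists
of the matrices [dual pi a b ⊙ S], where [dual pi a b] has entries
a_i + pi_i b_j. Hence the orthogonal projection of [X] is
[X - dual pi a b ⊙ S], where [a], [b] make this difference tangent, which is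
the linear system [margins_mx pi S *m col_mx a b = margins pi X]. When
[S *m ones = ones] this is the system of the theorem. Its matrix is symmetric
with kernel spanned by [gauge pi] = (pi, -1), and adding the rank-one matrix
[gauge *m gauge^T] makes it invertible without changing the solutions of
interest. This proves solvability for every right-hand side [margins pi X],
and writes the Riemannian gradient, which is the projection of
[Egrad f S ⊙ S], as a formula built from sums, products and one matrix inverse.
The gradient is therefore a smooth vector field, on which the axioms of the
connection can be used.

Constant matrices in the tangent space are smooth vector fields with vanishing
Lie brackets. For them the Koszul argument gives
<nabla_xi eta, zeta> = - 1/2 sum xi eta zeta / S^2, because the right-hand side
is symmetric in the three vectors. Differentiating <V, eta> for a constant
field eta and using metric compatibility then yields, for every smooth field
[V], the identity nabla_xi V = Pi_S (D_xi V - 1/2 (V ⊙ xi) ⊘ S)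
([levi_civita_fisher]), whence the first formula.

The derivative of the gradient is obtained without differentiating [a] and [b]
as functions of [S]. Differentiating <grad f, eta> = D_eta f along xi, for a
fixed tangent eta, determines the tangent vector D_xi (grad f) uniquely; the
proposed expression is tangent by the system for the dotted multipliers, and
satisfies the same equation ([derive_RgradE]). *)

Set Implicit Arguments.
Unset Strict Implicit.
Unset Printing Implicit Defensive.

(** * Calculus of C^k functions on an open set *)

Lemma near_eq_differentiable (R : realType) (V W : normedModType R)
    (F G : V -> W) (x : V) :
  (\near x, F x = G x) -> differentiable F x -> differentiable G x.
Proof.
move=> FG dF; have Fx : F x = G x := nbhs_singleton FG.
have dFc : continuous ('d F x) := diff_continuous dF.
have GE : G \o shift x = cst (G x) + 'd F x +o_ 0 id.
  apply/eqaddoP => e e0.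
  have /eqaddoP/(_ e e0) := diff_locally dF.
  have : \forall h \near 0, F (h + x) = G (h + x).
    by have := FG; rewrite (near_shift 0) => H; near=> h; near: h;
       apply: filterS H => h /=; rewrite subr0.
  by apply: filterS2 => h FGh; rewrite !fctE /= FGh Fx.
have dE := diff_unique dFc GE.
by apply/diff_locallyP; rewrite dE.
Unshelve. all: by end_near. Qed.

Section CkCalculus.
Context {R : realType} {V : normedModType R} {A : set V}.
Hypothesis Aopen : open A.

Lemma near_eq_on (W : normedModType R) (F G : V -> W) :
  (forall x, A x -> F x = G x) -> forall x, A x -> \near x, F x = G x.
Proof.
by move=> FG x Ax; near=> y; apply: FG; near: y; exact: open_nbhs_nbhs.
Unshelve. all: by end_near. Qed.

Lemma Ck_eq (W : normedModType R) k (F G : V -> W) :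
  (forall x, A x -> F x = G x) -> Ck k A F -> Ck k A G.
Proof.
elim: k F G => [|k IH] F G FG /=.
  move=> cF x Ax; rewrite /prop_for /continuous_at -(FG _ Ax).
  apply: cvg_trans (cF x Ax); apply: near_eq_cvg; exact: near_eq_on.
move=> [dF DF]; split=> [x Ax|v].
  apply: near_eq_differentiable (dF _ Ax); exact: near_eq_on.
apply: IH (DF v) => x Ax; apply: near_eq_derive; exact: near_eq_on.
Qed.

Lemma Ck_sub (W : normedModType R) k (B : set V) (F : V -> W) :
  A `<=` B -> Ck k B F -> Ck k A F.
Proof.
move=> AB; elim: k F => [|k IH] F /=; first by move=> cF x /AB/cF.
by move=> [dF DF]; split=> [x /AB/dF//|v]; exact: IH.
Qed.

Lemma CkW (W : normedModType R) k (F : V -> W) : Ck k.+1 A F -> Ck k A F.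
Proof.
elim: k F => [|k IH] F /= [dF DF].
  by move=> x /dF/differentiable_continuous.
by split=> // v; apply: IH; exact: DF.
Qed.

Lemma Ck_cst (W : normedModType R) k (a : W) : Ck k A (fun=> a).
Proof.
elim: k a => [|k IH] a /=; first by move=> x _; exact: cst_continuous.
split=> [x _|v]; first exact: differentiable_cst.
by apply: Ck_eq (IH 0) => x _; rewrite derive_cst.
Qed.

Lemma CkD (W : normedModType R) k (F G : V -> W) :
  Ck k A F -> Ck k A G -> Ck k A (fun x => F x + G x).
Proof.
elim: k F G => [|k IH] F G /=.
  by move=> cF cG x Ax; apply: continuousD; [exact: cF|exact: cG].
move=> [dF DF] [dG DG]; split=> [x Ax|v].
  by apply: differentiableD; [exact: dF|exact: dG].
apply: Ck_eq (IH _ _ (DF v) (DG v)) => x Ax; rewrite deriveD //.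
  exact/diff_derivable/dF.
exact/diff_derivable/dG.
Qed.

Lemma Ck_sum (W : normedModType R) k (I : finType) (F : I -> V -> W) :
  (forall i, Ck k A (F i)) -> Ck k A (fun x => \sum_i F i x).
Proof.
move=> cF.
suff H s : Ck k A (fun x => \sum_(i <- s) F i x) by exact: H.
elim: s => [|i s IH].
  by apply: Ck_eq (Ck_cst k (0 : W)) => x _; rewrite big_nil.
by apply: Ck_eq (CkD (cF i) IH) => x _; rewrite big_cons.
Qed.

Lemma CkM k (F G : V -> R) :
  Ck k A F -> Ck k A G -> Ck k A (fun x => F x * G x).
Proof.
elim: k F G => [|k IH] F G; move=> CF CG.
  by move=> x Ax; apply: continuousM; [exact: CF|exact: CG].
have [dF DF] := CF; have [dG DG] := CG; split=> [x Ax|v].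
  by apply: differentiableM; [exact: dF|exact: dG].
apply: Ck_eq (CkD (IH _ _ (CkW CF) (DG v)) (IH _ _ (CkW CG) (DF v))) => x Ax.
by rewrite deriveM //; exact/diff_derivable/dF || exact/diff_derivable/dG.
Qed.

Lemma Ck_prod k (I : finType) (F : I -> V -> R) :
  (forall i, Ck k A (F i)) -> Ck k A (fun x => \prod_i F i x).
Proof.
move=> cF.
suff H s : Ck k A (fun x => \prod_(i <- s) F i x) by exact: H.
elim: s => [|i s IH].
  by apply: Ck_eq (Ck_cst k (1 : R)) => x _; rewrite big_nil.
by apply: Ck_eq (CkM (cF i) IH) => x _; rewrite big_cons.
Qed.

Lemma CkN k (F : V -> R) : Ck k A F -> Ck k A (fun x => - F x).
Proof.
by move=> CF; apply: Ck_eq (CkM (Ck_cst k (-1 : R)) CF) => x _; rewrite mulN1r.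
Qed.

Lemma CkV k (F : V -> R) : (forall x, A x -> F x != 0) ->
  Ck k A F -> Ck k A (fun x => (F x)^-1).
Proof.
move=> F0; elim: k => [|k IH] CF.
  by move=> x Ax; apply: continuousV; [exact: F0|exact: CF].
have [dF DF] := CF; split=> [x Ax|v].
  by apply: differentiableV; [exact: dF|exact: F0].
have CV := IH (CkW CF).
apply: Ck_eq (CkN (CkM (CkM CV CV) (DF v))) => x Ax.
rewrite deriveV ?F0//; last exact/diff_derivable/dF.
by rewrite -mulNr expr2 invfM.
Qed.

Lemma CkZl (W : normedModType R) k (F : V -> R) (w : W) :
  Ck k A F -> Ck k A (fun x => F x *: w).
Proof.
elim: k F => [|k IH] F.
  by move=> cF x Ax; apply: continuousZr_tmp; exact: cF.
move=> [dF DF]; split=> [x Ax|v]; first exact/differentiableZl/dF.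
apply: Ck_eq (IH _ (DF v)) => x Ax.
rewrite [RHS]deriveE; last exact/differentiableZl/dF.
by rewrite diffZl ?deriveE //; exact: dF.
Qed.

Lemma Ck_mx k m p (F : V -> 'M[R]_(m, p)) :
  (forall i j, Ck k A (fun x => F x i j)) -> Ck k A F.
Proof.
move=> CF; apply: (@Ck_eq _ _
   (fun x => \sum_i \sum_j F x i j *: delta_mx i j)).
  by move=> x _; rewrite -matrix_sum_delta.
by apply: Ck_sum => i; apply: Ck_sum => j; exact: CkZl.
Qed.

End CkCalculus.

Lemma Ck_coord (R : realType) m p (A : set 'M[R]_(m, p)) k i j : open A ->
  Ck k A (fun X : 'M[R]_(m, p) => X i j).
Proof.
move=> Aopen; case: k => [|k]; first by move=> X _; exact: coord_continuous.
split=> [X _|v]; first exact: differentiable_coord.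
apply: (Ck_eq Aopen) (Ck_cst Aopen k (v i j)) => X _.
have idX : derivable (id : 'M[R]_(m, p) -> 'M[R]_(m, p)) X v.
  exact: derivable_id.
by have /matrixP/(_ i j) := derive_mx idX; rewrite derive_id mxE.
Qed.

(** * C^k matrix-valued functions *)

Lemma posmx_open (R : realType) (m p : nat) :
  open [set X : 'M[R]_(m, p) | forall i j, 0 < X i j].
Proof.
rewrite openE => X X0.
apply: (@filter_forall _ _
  (fun i => [set Y : 'M[R]_(m, p) | forall j, 0 < Y i j]) (nbhs X)) => i.
apply: (@filter_forall _ _ (fun j => [set Y : 'M[R]_(m, p) | 0 < Y i j])
  (nbhs X)) => j.
by have := cvgr_gt (X i j) (@coord_continuous R m p i j X) _ (X0 i j); exact.
Qed.

Section CkMatrix.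
Context {R : realType} {V : normedModType R} {A : set V}.
Hypothesis Aopen : open A.

Lemma Ck_entry k m p (F : V -> 'M[R]_(m, p)) i j :
  Ck k A F -> Ck k A (fun x => F x i j).
Proof.
elim: k F => [|k IH] F.
  move=> cF x Ax.
  exact: (continuous_comp (cF x Ax) (@coord_continuous _ _ _ _ _ _)).
move=> [dF DF]; split=> [x Ax|v].
  exact: differentiable_comp (dF x Ax) (differentiable_coord _ _ _).
apply: (Ck_eq Aopen) (IH _ (DF v)) => x Ax.
have dFv : derivable F x v by exact/diff_derivable/dF.
by rewrite (derive_mx dFv) mxE.
Qed.

Lemma Ck_mulmx k m p q (F : V -> 'M[R]_(m, p)) (G : V -> 'M[R]_(p, q)) :
  Ck k A F -> Ck k A G -> Ck k A (fun x => F x *m G x).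
Proof.
move=> CF CG; apply: Ck_mx => // i j.
apply: (@Ck_eq _ _ _ Aopen _ k (fun x => \sum_l F x i l * G x l j)) => [x _|].
  by rewrite mxE.
by apply: Ck_sum => // l; apply: CkM => //; exact: Ck_entry.
Qed.

Lemma Ck_hmul k m p (F G : V -> 'M[R]_(m, p)) :
  Ck k A F -> Ck k A G -> Ck k A (fun x => F x ⊙ G x).
Proof.
move=> CF CG; apply: Ck_mx => // i j.
apply: (@Ck_eq _ _ _ Aopen _ k (fun x => F x i j * G x i j)) => [x _|].
  by rewrite mxE.
by apply: CkM => //; exact: Ck_entry.
Qed.

Lemma Ck_tr k m p (F : V -> 'M[R]_(m, p)) :
  Ck k A F -> Ck k A (fun x => (F x)^T).
Proof.
move=> CF; apply: Ck_mx => // i j.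
apply: (@Ck_eq _ _ _ Aopen _ k (fun x => F x j i)) => [x _|].
  by rewrite mxE.
exact: Ck_entry.
Qed.

Lemma Ck_mxsub k m p m' p' (F : V -> 'M[R]_(m, p)) (r : 'I_m' -> 'I_m)
    (c : 'I_p' -> 'I_p) :
  Ck k A F -> Ck k A (fun x => mxsub r c (F x)).
Proof.
move=> CF; apply: Ck_mx => // i j.
apply: (@Ck_eq _ _ _ Aopen _ k (fun x => F x (r i) (c j))) => [x _|].
  by rewrite mxE.
exact: Ck_entry.
Qed.

Lemma Ck_diag k m (F : V -> 'rV[R]_m) :
  Ck k A F -> Ck k A (fun x => diag_mx (F x)).
Proof.
move=> CF; apply: Ck_mx => // i j; have [<-|ij] := eqVneq i j.
  apply: (@Ck_eq _ _ _ Aopen _ k (fun x => F x 0 i)) => [x _|].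
    by rewrite mxE eqxx.
  exact: Ck_entry.
apply: (@Ck_eq _ _ _ Aopen _ k (fun x => 0 : R)) => [x _|].
  by rewrite mxE (negbTE ij).
exact: Ck_cst.
Qed.

Lemma Ck_row_mx k m p q (F : V -> 'M[R]_(m, p)) (G : V -> 'M[R]_(m, q)) :
  Ck k A F -> Ck k A G -> Ck k A (fun x => row_mx (F x) (G x)).
Proof.
move=> CF CG; apply: Ck_mx => // i j; case: (split_ordP j) => l ->.
  apply: (@Ck_eq _ _ _ Aopen _ k (fun x => F x i l)) => [x _|].
    by rewrite row_mxEl.
  exact: Ck_entry.
apply: (@Ck_eq _ _ _ Aopen _ k (fun x => G x i l)) => [x _|].
  by rewrite row_mxEr.
exact: Ck_entry.
Qed.

Lemma Ck_col_mx k m p q (F : V -> 'M[R]_(m, p)) (G : V -> 'M[R]_(q, p)) :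
  Ck k A F -> Ck k A G -> Ck k A (fun x => col_mx (F x) (G x)).
Proof.
move=> CF CG; have := Ck_tr (Ck_row_mx (Ck_tr CF) (Ck_tr CG)).
by apply: (Ck_eq Aopen) => x _; rewrite tr_row_mx !trmxK.
Qed.

Lemma Ck_det k m (F : V -> 'M[R]_m) :
  Ck k A F -> Ck k A (fun x => \det (F x)).
Proof.
move=> CF; apply: Ck_sum => // s; apply: CkM => //; first exact: Ck_cst.
by apply: Ck_prod => // i; exact: Ck_entry.
Qed.

Lemma Ck_invmx k m (F : V -> 'M[R]_m) : (forall x, A x -> F x \in unitmx) ->
  Ck k A F -> Ck k A (fun x => invmx (F x)).
Proof.
move=> uF CF; apply: Ck_mx => // i j.
apply: (@Ck_eq _ _ _ Aopen _ k
  (fun x => (\det (F x))^-1 * cofactor (F x) j i)) => [x /uF uFx|].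
  by rewrite /invmx uFx !mxE.
apply: CkM => //.
  apply: CkV => // [x /uF|]; last exact: Ck_det.
  by rewrite unitmxE unitfE.
apply: CkM => //; first exact: Ck_cst.
have CF' := Ck_mxsub (lift j) (lift i) CF.
apply: (Ck_eq Aopen) (Ck_det CF') => x _; congr (\det _).
by apply/matrixP => a b; rewrite !mxE.
Qed.

Lemma Ck_mxB k m p (F G : V -> 'M[R]_(m, p)) :
  Ck k A F -> Ck k A G -> Ck k A (fun x => F x - G x).
Proof.
move=> CF CG; apply: Ck_mx => // i j.
apply: (@Ck_eq _ _ _ Aopen _ k (fun x => F x i j + - G x i j)) => [x _|].
  by rewrite !mxE.
by apply: CkD => //; [|apply: CkN => //]; exact: Ck_entry.
Qed.

End CkMatrix.

(** * The Fisher inner product and its orthogonal projection *)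

Section FisherProduct.
Context {R : realType} {n : nat}.
Implicit Types (pi a b : 'cV[R]_n) (S X Y Z : 'M[R]_n) (f : 'M[R]_n -> R).

Lemma frobE X Y : frob X Y = \sum_i \sum_j X i j * Y i j.
Proof.
rewrite /frob /mxtrace; apply: eq_bigr => i _; rewrite mxE.
by apply: eq_bigr => j _; rewrite mxE.
Qed.

Lemma fisherDl S X Y Z : fisher S (X + Y) Z = fisher S X Z + fisher S Y Z.
Proof.
rewrite /fisher -big_split; apply: eq_bigr => i _ /=.
by rewrite -big_split; apply: eq_bigr => j _ /=; rewrite mxE !mulrDl.
Qed.

Lemma fisherZl S c X Z : fisher S (c *: X) Z = c * fisher S X Z.
Proof.
rewrite /fisher mulr_sumr; apply: eq_bigr => i _ /=.
by rewrite mulr_sumr; apply: eq_bigr => j _ /=; rewrite mxE !mulrA.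
Qed.

Lemma fisherNl S X Z : fisher S (- X) Z = - fisher S X Z.
Proof. by rewrite -scaleN1r fisherZl mulN1r. Qed.

Lemma fisherBl S X Y Z : fisher S (X - Y) Z = fisher S X Z - fisher S Y Z.
Proof. by rewrite fisherDl fisherNl. Qed.

Lemma fisherC S X Y : fisher S X Y = fisher S Y X.
Proof.
by apply: eq_bigr => i _; apply: eq_bigr => j _; rewrite (mulrC (X i j)).
Qed.

(** Against matrices of the form [X ⊙ S] the Fisher metric is the Euclidean one. *)
Lemma fisher_hmul S X Y : (forall i j, 0 < S i j) ->
  fisher S (X ⊙ S) Y = frob X Y.
Proof.
move=> S0; rewrite frobE; apply: eq_bigr => i _; apply: eq_bigr => j _.
by rewrite !mxE mulrAC mulfK // gt_eqF.
Qed.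

Lemma fisher_definite S X : (forall i j, 0 < S i j) ->
  fisher S X X = 0 -> X = 0.
Proof.
move=> S0 X0; have t0 i j : 0 <= X i j * X i j / S i j.
  by rewrite mulr_ge0 ?invr_ge0 ?(ltW (S0 i j)) // -expr2 sqr_ge0.
apply/matrixP => i j; rewrite mxE.
have r0 k : 0 <= \sum_j X k j * X k j / S k j by rewrite sumr_ge0.
have Xi0 : \sum_j X i j * X i j / S i j = 0.
  by apply: (psumr_eq0P _ X0) => // k _; exact: r0.
have /eqP : X i j * X i j / S i j = 0.
  by apply: (psumr_eq0P _ Xi0) => // k _; exact: t0.
by rewrite !mulf_eq0 invr_eq0 (gt_eqF (S0 i j)) orbF orbb => /eqP.
Qed.

Lemma tangentB pi X Y : tangent pi X -> tangent pi Y -> tangent pi (X - Y).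
Proof.
by move=> [X1 piX] [Y1 piY]; split; rewrite ?mulmxBl ?mulmxBr ?X1 ?Y1 ?piX ?piY
  subrr.
Qed.

Lemma tangentZ pi c X : tangent pi X -> tangent pi (c *: X).
Proof.
by move=> [X1 piX]; split; rewrite -?scalemxAl -?scalemxAr ?X1 ?piX scaler0.
Qed.

Lemma fisher_tangent_inj pi S X Y : (forall i j, 0 < S i j) ->
  tangent pi X -> tangent pi Y ->
  (forall Z, tangent pi Z -> fisher S X Z = fisher S Y Z) -> X = Y.
Proof.
move=> S0 TX TY XY; apply/eqP; rewrite -subr_eq0; apply/eqP.
have TXY := tangentB TX TY.
by apply: (fisher_definite S0); rewrite fisherBl XY // subrr.
Qed.

(** [Rgrad] is a choice among all gradients; definiteness of the metric makes
the choice unique as soon as a gradient exists. The same holds for [tproj]. *)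
Lemma is_gradient_fisher_uniq pi S f X : (forall i j, 0 < S i j) ->
  is_gradient (fisher S) (tangent pi) f S X -> Rgrad pi f S = X.
Proof.
move=> S0 GX; apply: xget_unique => // Y [TY GY].
have [TX {}GX] := GX; apply: (fisher_tangent_inj S0 TY TX) => Z TZ.
by rewrite GX // GY.
Qed.

Lemma tproj_uniq pi S X Y : (forall i j, 0 < S i j) -> tangent pi Y ->
  (forall Z, tangent pi Z -> fisher S (X - Y) Z = 0) -> tproj pi S X = Y.
Proof.
move=> S0 TY XY; apply: xget_unique => // P [TP XP].
apply: (fisher_tangent_inj S0 TP TY) => Z TZ.
apply/eqP; rewrite eq_sym -subr_eq0; apply/eqP.
rewrite -fisherBl -(subrKA X) fisherDl XP // addr0.
by rewrite -opprB fisherNl XY // oppr0.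
Qed.

End FisherProduct.

Section DualSystem.
Context {R : realType} {n : nat} (pi : 'cV[R]_n).
Hypotheses (pi_gt0 : forall i, 0 < pi i 0) (pi_sum1 : pi^T *m ones = 1%:M).
Implicit Types (a b : 'cV[R]_n) (S X Y Z : 'M[R]_n).

(** Row sums of [X] and [pi]-weighted column sums of [X], stacked. The tangent
space is the set where they vanish. *)
Definition margins X : 'cV[R]_(n + n) := col_mx (X *m ones) (X^T *m pi).

(** The normal space at [S] for the Fisher metric is the set of the
[dual a b ⊙ S]; the vectors [a] and [b] are the Lagrange multipliers of the two
families of linear constraints that define the tangent space. *)
Definition dual a b : 'M[R]_n := a *m ones^T + pi *m b^T.

(** The matrix of the linear map sending the multipliers (a, b) to the margins
of [dual a b ⊙ X]. The upper left block is the identity when the rows of [X] sum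
to 1, and 0 when they sum to 0. *)
Definition margins_mx X : 'M[R]_(n + n) :=
  block_mx (diagc (X *m ones)) (diagc pi *m X)
           (X^T *m diagc pi) (diagc (X^T *m diagc pi *m pi)).

Lemma tangent_margins X : tangent pi X <-> margins X = 0.
Proof.
split=> [[X1 piX]|].
  by rewrite /margins X1 -(trmxK pi) -trmx_mul piX trmx0 col_mx0.
rewrite -[0]col_mx0 => /eq_col_mx[X1 Xpi]; split=> //.
by rewrite -[LHS]trmxK trmx_mul trmxK Xpi trmx0.
Qed.

Lemma marginsB X Y : margins (X - Y) = margins X - margins Y.
Proof.
by rewrite /margins opp_col_mx add_col_mx raddfB /= !mulmxBl.
Qed.

Lemma dualE a b i j : dual a b i j = a i 0 + pi i 0 * b j 0.
Proof. by rewrite !mxE !big_ord1 !mxE mulr1. Qed.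

Lemma diagc_mulE (x : 'cV[R]_n) m (X : 'M[R]_(n, m)) i j :
  (diagc x *m X) i j = x i 0 * X i j.
Proof. by rewrite mul_diag_mx !mxE. Qed.

Lemma mul_diagcE (x : 'cV[R]_n) m (X : 'M[R]_(m, n)) i j :
  (X *m diagc x) i j = X i j * x j 0.
Proof. by rewrite mul_mx_diag !mxE. Qed.

Lemma margins_dual X a b :
  margins (dual a b ⊙ X) = margins_mx X *m col_mx a b.
Proof.
rewrite mul_block_col; congr col_mx; apply/matrixP => i j; rewrite ord1.
  rewrite [RHS]mxE diagc_mulE !mxE mulr_suml -big_split.
  apply: eq_bigr => k _ /=; rewrite [ones _ _]mxE [(_ ⊙ _) _ _]mxE dualE.
  by rewrite diagc_mulE; ring.
rewrite [RHS]mxE diagc_mulE !mxE mulr_suml -big_split.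
apply: eq_bigr => k _ /=; rewrite [(_ ⊙ _)^T _ _]mxE [(_ ⊙ _) _ _]mxE dualE.
by rewrite mul_diagcE [X^T _ _]mxE; ring.
Qed.

(** [dual] is the adjoint of [margins]. *)
Lemma frob_dual a b X :
  frob (dual a b) X = ((col_mx a b)^T *m margins X) 0 0.
Proof.
rewrite tr_col_mx mul_row_col frobE !mxE.
under eq_bigr do under eq_bigr do rewrite dualE mulrDl.
under eq_bigr do rewrite big_split.
rewrite big_split; congr (_ + _).
  apply: eq_bigr => i _; rewrite -mulr_sumr !mxE; congr (_ * _).
  by apply: eq_bigr => k _; rewrite !mxE mulr1.
rewrite exchange_big; apply: eq_bigr => i _ /=; rewrite !mxE mulr_sumr.
by apply: eq_bigr => k _; rewrite !mxE; ring.
Qed.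

Lemma frob_dual_tangent a b X : tangent pi X -> frob (dual a b) X = 0.
Proof. by move=> /tangent_margins X0; rewrite frob_dual X0 mulmx0 mxE. Qed.

(** The ambiguity of the multipliers: [dual a b] is unchanged when a multiple
of (pi, -1) is added to (a, b). *)
Definition gauge : 'cV[R]_(n + n) := col_mx pi (- ones).

Lemma dual_gauge : dual pi (- ones) = 0.
Proof.
by apply/matrixP => i j; rewrite dualE !mxE mulrN mulr1 subrr.
Qed.

Lemma gauge_margins X : gauge^T *m margins X = 0.
Proof.
apply/matrixP => i j; rewrite !ord1.
rewrite -frob_dual dual_gauge mxE frobE big1 // => k _.
by rewrite big1 // => l _; rewrite mxE mul0r.
Qed.

Lemma margins_mx_sym X : (margins_mx X)^T = margins_mx X.
Proof.
have diagcT x : (diagc x)^T = diagc x := tr_diag_mx _.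
by rewrite tr_block_mx !diagcT [(_ *m X)^T]trmx_mul [(X^T *m _)^T]trmx_mul trmxK
  !diagcT.
Qed.

Lemma gauge_margins_mx X : gauge^T *m margins_mx X = 0.
Proof.
apply: trmx_inj; rewrite trmx_mul trmxK margins_mx_sym trmx0 -margins_dual.
rewrite dual_gauge /margins (_ : 0 ⊙ X = 0) ?trmx0 ?mul0mx ?col_mx0 //.
by apply/matrixP => i j; rewrite !mxE mul0r.
Qed.

(** The system matrix made invertible by the rank-one term [gauge *m gauge^T],
which fixes the ambiguity by forcing the solution to be orthogonal to [gauge]. *)
Definition gauged_mx X : 'M[R]_(n + n) := margins_mx X + gauge *m gauge^T.

Lemma gauge_sqr_gt0 : 0 < (gauge^T *m gauge) 0 0.
Proof.
(* [pi_sum1] excludes the empty size, for which [gauge] would be zero. *)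
rewrite tr_col_mx mul_row_col !mxE; case: n pi pi_gt0 pi_sum1 => [|m] p p0 p1.
  have /matrixP/(_ 0 0) := p1; rewrite !mxE big_ord0 => /eqP.
  by rewrite eq_sym oner_eq0.
apply: ltr_pwDl.
  rewrite big_ord_recl ltr_pwDl ?sumr_ge0 //= ?mxE ?mulr_gt0 // => i _.
  by rewrite mxE mulr_ge0 // ltW.
by rewrite sumr_ge0 // => i _; rewrite !mxE mulrNN mulr1.
Qed.

Lemma gauge_sqr_inj (x : 'M[R]_1) : gauge^T *m gauge *m x = 0 -> x = 0.
Proof.
move=> /matrixP/(_ 0 0); rewrite mxE big_ord1 [RHS]mxE => /eqP.
rewrite mulf_eq0 (gt_eqF gauge_sqr_gt0) /= => /eqP x0.
by apply/matrixP => i j; rewrite !ord1 x0 mxE.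
Qed.

(** Since [gauge] is in the left kernel of [margins_mx X], pairing the modified
system with it leaves only [gauge^T *m c], up to a nonzero factor. *)
Lemma gauged_mx_fix X (c d : 'cV[R]_(n + n)) : gauge^T *m d = 0 ->
  gauged_mx X *m c = d -> margins_mx X *m c = d /\ gauge^T *m c = 0.
Proof.
move=> gd cd; suff gc : gauge^T *m c = 0.
  by split=> //; rewrite -cd mulmxDl -mulmxA gc mulmx0 addr0.
have : gauge^T *m (gauged_mx X *m c) = 0 by rewrite cd.
rewrite mulmxDl mulmxDr !mulmxA gauge_margins_mx mul0mx add0r => ggc.
by apply: gauge_sqr_inj; rewrite mulmxA.
Qed.

(** If [dual a b ⊙ S] has zero margins then it is tangent, and being also normal
it is zero. *)
Lemma margins_mx_ker S a b : (forall i j, 0 < S i j) ->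
  margins_mx S *m col_mx a b = 0 -> dual a b = 0.
Proof.
move=> S0; rewrite -margins_dual => /tangent_margins TN.
have N0 := fisher_hmul (dual a b) (dual a b ⊙ S) S0.
rewrite (frob_dual_tangent _ _ TN) in N0.
have {N0 TN}/matrixP N0 := fisher_definite S0 N0.
apply/matrixP => i j; have /eqP := N0 i j.
by rewrite !mxE mulf_eq0 (gt_eqF (S0 i j)) orbF => /eqP.
Qed.

Lemma dual_eq0_gauge a b : dual a b = 0 ->
  exists t, col_mx a b = t *: gauge.
Proof.
move=> /matrixP d0.
case: (pickP (fun i : 'I_n => true)) => [i0 _|none]; last first.
  exists 0; apply/matrixP => i j; rewrite mxE; case: (split_ordP i) => k _.
    by have := none k.
  by have := none k.
exists (- b i0 0); rewrite scale_col_mx; congr col_mx; apply/matrixP => i j;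
  rewrite ord1.
  have := d0 i i0; rewrite dualE !mxE => /eqP.
  by rewrite addr_eq0 => /eqP ->; ring.
have pb : pi i0 0 * b i 0 = pi i0 0 * b i0 0.
  by apply: (addrI (a i0 0)); rewrite -!dualE !d0 !mxE.
by rewrite !mxE mulrNN mulr1; apply: mulfI pb; rewrite gt_eqF.
Qed.

Lemma gauged_mx_unit S : (forall i j, 0 < S i j) -> gauged_mx S \in unitmx.
Proof.
move=> S0; rewrite -row_free_unit -kermx_eq0; apply/rowV0P => v /sub_kermxP vA.
apply: trmx_inj; rewrite trmx0.
have Av : gauged_mx S *m v^T = 0.
  rewrite -[RHS]trmx0 -vA trmx_mul; congr (_ *m _).
  by rewrite linearD /= margins_mx_sym trmx_mul trmxK.
have [] := gauged_mx_fix (mulmx0 _ _) Av.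
rewrite -[v^T]vsubmxK => /(margins_mx_ker S0)/dual_eq0_gauge[t ->].
rewrite -scalemxAr => /matrixP/(_ 0 0); rewrite mxE [RHS]mxE => /eqP.
by rewrite mulf_eq0 (gt_eqF gauge_sqr_gt0) orbF => /eqP->; rewrite scale0r.
Qed.

(** The solution orthogonal to [gauge] of the system with right-hand side
[margins X]. *)
Definition multipliers S X : 'cV[R]_(n + n) :=
  invmx (gauged_mx S) *m margins X.

Lemma multipliersP S X : (forall i j, 0 < S i j) ->
  margins_mx S *m multipliers S X = margins X.
Proof.
move=> S0; have := gauged_mx_unit S0 => uS.
by have [] := @gauged_mx_fix S (multipliers S X) _ (gauge_margins X)
  (mulKVmx uS _).
Qed.

(** Closed formula for the orthogonal projection onto the tangent space. *)
Definition fproj S X : 'M[R]_n :=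
  X - dual (usubmx (multipliers S X)) (dsubmx (multipliers S X)) ⊙ S.

Lemma dual_proj_tangent S X a b : margins_mx S *m col_mx a b = margins X ->
  tangent pi (X - dual a b ⊙ S).
Proof.
by move=> ab; apply/tangent_margins; rewrite marginsB margins_dual ab subrr.
Qed.

Lemma fproj_tangent S X : (forall i j, 0 < S i j) -> tangent pi (fproj S X).
Proof.
by move=> S0; apply: dual_proj_tangent; rewrite vsubmxK multipliersP.
Qed.

Lemma dual_proj_fisher S X a b Z : (forall i j, 0 < S i j) -> tangent pi Z ->
  fisher S (X - dual a b ⊙ S) Z = fisher S X Z.
Proof.
by move=> S0 TZ; rewrite fisherBl fisher_hmul // frob_dual_tangent // subr0.
Qed.

Lemma tproj_fproj S X : (forall i j, 0 < S i j) -> tproj pi S X = fproj S X.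
Proof.
move=> S0; apply: tproj_uniq => // [|Z TZ]; first exact: fproj_tangent.
by rewrite fisherBl dual_proj_fisher // subrr.
Qed.

Lemma tproj_tangent S X : (forall i j, 0 < S i j) -> tangent pi (tproj pi S X).
Proof. by move=> S0; rewrite tproj_fproj //; exact: fproj_tangent. Qed.

Lemma fisher_tproj S X Z : (forall i j, 0 < S i j) -> tangent pi Z ->
  fisher S (tproj pi S X) Z = fisher S X Z.
Proof. by move=> S0 TZ; rewrite tproj_fproj // dual_proj_fisher. Qed.

Lemma tprojB S X Y : (forall i j, 0 < S i j) ->
  tproj pi S (X - Y) = tproj pi S X - tproj pi S Y.
Proof.
move=> S0; apply: tproj_uniq => // [|Z TZ].
  by apply: tangentB; exact: tproj_tangent.
by rewrite !fisherBl !fisher_tproj // subrr.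
Qed.

Lemma tprojZ S c X : (forall i j, 0 < S i j) ->
  tproj pi S (c *: X) = c *: tproj pi S X.
Proof.
move=> S0; apply: tproj_uniq => // [|Z TZ].
  by apply: tangentZ; exact: tproj_tangent.
by rewrite !(fisherBl, fisherZl) fisher_tproj // subrr.
Qed.

End DualSystem.

(** * The Euclidean gradient *)

Section EuclideanGradient.
Context {R : realType} {n : nat}.
Implicit Types (f : 'M[R]_n -> R) (S X eta : 'M[R]_n).

Lemma frob_delta X i j : frob X (delta_mx i j) = X i j.
Proof.
rewrite frobE (bigD1 i) //= (bigD1 j) //= !mxE !eqxx mulr1.
rewrite big1 ?addr0 => [|k /negbTE kj]; last by rewrite mxE kj andbF mulr0.
rewrite big1 ?addr0 // => k /negbTE ki.
by rewrite big1 // => l _; rewrite mxE ki mulr0.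
Qed.

(** For a differentiable function the matrix of partial derivatives is the
Euclidean gradient. *)
Lemma frob_partials f S eta : differentiable f S ->
  frob (\matrix_(i, j) 'D_(delta_mx i j) f S) eta = 'D_eta f S.
Proof.
move=> df; rewrite [RHS]deriveE // {2}(matrix_sum_delta eta) frobE linear_sum.
apply: eq_bigr => i _; rewrite linear_sum; apply: eq_bigr => j _.
by rewrite linearZ mxE deriveE //= mulrC.
Qed.

Lemma EgradE f S : differentiable f S ->
  Egrad f S = \matrix_(i, j) 'D_(delta_mx i j) f S.
Proof.
move=> df; apply: xget_unique; first by split=> // X _; exact: frob_partials.
move=> G [_ GE]; apply/matrixP => i j.
by rewrite -frob_delta GE // mxE.
Qed.

Lemma frob_Egrad f S eta : differentiable f S ->
  frob (Egrad f S) eta = 'D_eta f S.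
Proof. by move=> df; rewrite EgradE // frob_partials. Qed.

Lemma Ck_Egrad (A : set 'M[R]_n) f k : open A -> Ck k.+1 A f ->
  Ck k A (Egrad f).
Proof.
move=> Aopen [df Df].
apply: (@Ck_eq _ _ _ Aopen _ k
  (fun S => \matrix_(i, j) 'D_(delta_mx i j) f S)) => [S AS|].
  by rewrite EgradE //; exact: df.
apply: Ck_mx => // i j.
by apply: (Ck_eq Aopen) (Df (delta_mx i j)) => S _; rewrite mxE.
Qed.

End EuclideanGradient.

(** * Directional derivatives of the metric *)

Section DirectionalDerivatives.
Context {R : realType} {n : nat}.
Implicit Types (S X Y xi eta : 'M[R]_n) (V : 'M[R]_n -> 'M[R]_n).

Lemma hmulC X Y : X ⊙ Y = Y ⊙ X.
Proof. by apply/matrixP => i j; rewrite !mxE mulrC. Qed.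

(** The cubic form sum X Y Z / S^2 is symmetric; here in its outer arguments. *)
Lemma fisher_cubicC S X Y Z :
  fisher S ((X ⊙ Y) ⊘ S) Z = fisher S ((Z ⊙ Y) ⊘ S) X.
Proof.
apply: eq_bigr => i _; apply: eq_bigr => j _; rewrite !mxE; congr (_ / _).
by rewrite mulrAC [RHS]mulrAC; congr (_ / _); ring.
Qed.

Lemma is_derive_sumE (W : normedModType R) (U : normedModType R) (x v : U)
    m (h : 'I_m -> U -> W) (dh : 'I_m -> W) :
  (forall i, is_derive x v (h i) (dh i)) ->
  is_derive x v (fun y => \sum_i h i y) (\sum_i dh i).
Proof.
move=> hd; have := is_derive_sum hd.
by congr is_derive; apply/funext => y; rewrite fct_sumE.
Qed.

Lemma is_derive_entry V S xi (V' : 'M[R]_n) i j : is_derive S xi V V' ->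
  is_derive S xi (fun Z => V Z i j) (V' i j).
Proof.
move=> [dV <-]; rewrite (derive_mx dV) mxE; apply: derivableP.
by have /derivable_mxP := dV; exact.
Qed.

Lemma is_derive_frob V S xi (V' : 'M[R]_n) X : is_derive S xi V V' ->
  is_derive S xi (fun Z => frob X (V Z)) (frob X V').
Proof.
move=> dV; rewrite frobE (_ : (fun _ => _) =
  fun Z => \sum_i \sum_j X i j * V Z i j); last first.
  by apply/funext => Z; rewrite frobE.
apply: is_derive_sumE => i; apply: is_derive_sumE => j.
exact/is_deriveZ/is_derive_entry.
Qed.

(** The base point of the metric and the field both move: the variation of
1 / S contributes the term in [(V S ⊙ xi) ⊘ S]. *)
Lemma is_derive_fisher V S xi (V' : 'M[R]_n) eta : (forall i j, 0 < S i j) ->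
  is_derive S xi V V' ->
  is_derive S xi (fun Z => fisher Z (V Z) eta)
    (fisher S (V' - (V S ⊙ xi) ⊘ S) eta).
Proof.
move=> S0 dV; apply: is_derive_sumE => i; apply: is_derive_sumE => j.
have dVij := is_derive_entry i j dV.
have dSij : is_derive S xi (fun Z : 'M[R]_n => Z i j) (xi i j).
  exact: (is_derive_entry i j (is_derive_id S xi)).
have Sij0 : S i j != 0 by rewrite gt_eqF.
have dSV : is_derive S xi (fun Z : 'M[R]_n => (Z i j)^-1)
    (- (S i j) ^- 2 *: xi i j).
  split; first exact: derivableV.
  by rewrite deriveV // derive_val.
have dVeta : is_derive S xi (fun Z => V Z i j * eta i j) (eta i j *: V' i j).
  rewrite (_ : (fun _ => _) = eta i j \*: (fun Z => V Z i j)); last first.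
    by apply/funext => Z; rewrite mulrC.
  exact: is_deriveZ.
apply: (is_derive_eq (is_deriveM dVeta dSV)).
by rewrite !mxE /GRing.scale /=; field.
Qed.

End DirectionalDerivatives.

Section Tangency.
Context {R : realType} {n : nat} (pi : 'cV[R]_n).
Implicit Types (S X Y xi eta : 'M[R]_n) (V : 'M[R]_n -> 'M[R]_n).

(** Testing against the margins of [X] themselves shows that they vanish. *)
Lemma tangent_frob_dual X :
  (forall a b : 'cV[R]_n, frob (dual pi a b) X = 0) -> tangent pi X.
Proof.
move=> X0; apply/tangent_margins; apply/matrixP => i j.
have := X0 (usubmx (margins pi X)) (dsubmx (margins pi X)).
rewrite frob_dual vsubmxK mxE => sq0; rewrite ord1 [RHS]mxE.
have /eqP : (margins pi X)^T 0 i * margins pi X i 0 = 0.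
  by apply: (psumr_eq0P _ sq0) => // k _; rewrite mxE -expr2 sqr_ge0.
by rewrite mxE mulf_eq0 orbb => /eqP.
Qed.

Lemma tangent_derive V S xi (V' : 'M[R]_n) :
  (\forall Z \near S, tangent pi (V Z)) ->
  is_derive S xi V V' -> tangent pi V'.
Proof.
move=> TV dV; apply: tangent_frob_dual => a b.
have dF := is_derive_frob (dual pi a b) dV.
have F0 : \forall Z \near S, frob (dual pi a b) (V Z) = 0.
  by apply: filterS TV => Z TZ; exact: frob_dual_tangent.
have := near_eq_derive xi F0; rewrite derive_val => ->.
exact: derive_cst.
Qed.

End Tangency.

(** * The Levi-Civita connection *)

Section KoszulFormula.
Context {R : realType} {n : nat} (pi : 'cV[R]_n).
Variable nabla : 'M[R]_n -> 'M[R]_n -> ('M[R]_n -> 'M[R]_n) -> 'M[R]_n.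
Hypothesis nablaP : levi_civita pi nabla.
Implicit Types (S X Y xi eta : 'M[R]_n) (V : 'M[R]_n -> 'M[R]_n).

Lemma smooth_field_cst xi : tangent pi xi -> smooth_field pi (fun=> xi).
Proof.
move=> Txi; split=> //; exists setT, (fun=> xi); split=> //.
  exact: openT.
by move=> k; apply: Ck_cst; exact: openT.
Qed.

Lemma levi_civita_tangent S xi V : stoch pi S -> tangent pi xi ->
  smooth_field pi V -> tangent pi (nabla S xi V).
Proof.
move=> hS hxi hV.
have [+ _] := connection_field (levi_civita_connection nablaP)
  (smooth_field_cst hxi) hV.
exact.
Qed.

(** The Koszul argument for constant fields: torsion-freeness makes the
connection symmetric, and the three metric identities obtained by permuting
[xi], [eta], [zeta] have the same left-hand side. *)
Lemma levi_civita_cst S xi eta zeta : stoch pi S ->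
  tangent pi xi -> tangent pi eta -> tangent pi zeta ->
  fisher S (nabla S xi (fun=> eta)) zeta =
  - (2^-1 * fisher S ((eta ⊙ xi) ⊘ S) zeta).
Proof.
move=> hS hxi heta hzeta; have [_ _ S0] := hS.
have sym a b : tangent pi a -> tangent pi b ->
    nabla S a (fun=> b) = nabla S b (fun=> a).
  move=> ha hb.
  have := levi_civita_torsion_free nablaP hS
    (smooth_field_cst ha) (smooth_field_cst hb).
  by rewrite !derive_cst subrr => /eqP; rewrite subr_eq0 => /eqP.
have metric a b c : tangent pi a -> tangent pi b -> tangent pi c ->
    - fisher S ((b ⊙ a) ⊘ S) c =
    fisher S (nabla S a (fun=> b)) c + fisher S (nabla S a (fun=> c)) b.
  move=> ha hb hc.
  have := levi_civita_metric nablaP hS ha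
    (smooth_field_cst hb) (smooth_field_cst hc).
  have dcst := @is_derive_cst R 'M[R]_n 'M[R]_n b S a.
  rewrite (@derive_val _ _ _ _ _ _ _ (is_derive_fisher c S0 dcst)).
  move=> /=; rewrite (fisherC S b) => <-.
  by rewrite sub0r fisherNl.
have := metric _ _ _ hxi heta hzeta.
have := metric _ _ _ heta hxi hzeta.
have := metric _ _ _ hzeta hxi heta.
rewrite (sym _ _ heta hxi) (sym _ _ hzeta hxi) (sym _ _ hzeta heta).
rewrite (hmulC xi eta) (hmulC xi zeta) (fisher_cubicC S zeta xi eta).
by lra.
Qed.

(** The Levi-Civita connection of the Fisher metric. *)
Lemma levi_civita_fisher S xi V : stoch pi S -> tangent pi xi ->
  smooth_field pi V -> derivable V S xi -> tangent pi ('D_xi V S) ->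
  nabla S xi V = tproj pi S ('D_xi V S - 2^-1 *: ((V S ⊙ xi) ⊘ S)).
Proof.
move=> hS hxi hV dV TDV; have [_ _ S0] := hS.
have TV : tangent pi (V S) by apply: hV.1.
apply/esym/tproj_uniq => // [|eta heta]; first exact: levi_civita_tangent.
have := levi_civita_metric nablaP hS hxi hV (smooth_field_cst heta).
have D := is_derive_fisher eta S0 (derivableP dV).
rewrite (@derive_val _ _ _ _ _ _ _ D).
rewrite [in X in _ = _ + X]fisherC levi_civita_cst // !fisherBl fisherZl.
by rewrite (fisher_cubicC S eta); lra.
Qed.

End KoszulFormula.

(** * The Riemannian gradient *)

Section RiemannianGradient.
Context {R : realType} {n : nat} (pi : 'cV[R]_n).
Hypotheses (pi_gt0 : forall i, 0 < pi i 0) (pi_sum1 : pi^T *m ones = 1%:M).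
Variables (f : 'M[R]_n -> R) (Omega : set 'M[R]_n).
Hypotheses (Omega_open : open Omega) (f_smooth : smooth_on Omega f).
Implicit Types (S X Y xi eta : 'M[R]_n).

(* Matrices with positive entries in the domain of [f]. The gradient keeps its
closed formula on this open set, not only on the submanifold, so its ambient
derivatives can be computed there. *)
Let P : set 'M[R]_n := Omega `&` [set S | forall i j, 0 < S i j].

Let Popen : open P.
Proof. by apply: openI => //; exact: posmx_open. Qed.

Lemma Rgrad_fproj S : P S -> Rgrad pi f S = fproj pi S (Egrad f S ⊙ S).
Proof.
move=> [OS S0]; apply: is_gradient_fisher_uniq => //.
split=> [|X TX]; first exact: fproj_tangent.
have [df _] := f_smooth 1.
by rewrite dual_proj_fisher // fisher_hmul // frob_Egrad //; exact: df.
Qed.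

Lemma Rgrad_tangent S : P S -> tangent pi (Rgrad pi f S).
Proof.
by move=> PS; rewrite Rgrad_fproj //; case: PS => _; exact: fproj_tangent.
Qed.

Lemma Rgrad_smooth : smooth_on P (Rgrad pi f).
Proof.
move=> k.
apply: (@Ck_eq _ _ _ Popen _ k
  (fun S => fproj pi S (Egrad f S ⊙ S))) => [S PS|].
  by rewrite Rgrad_fproj.
have Cid : Ck k P (fun S : 'M[R]_n => S).
  by apply: Ck_mx => // i j; exact: Ck_coord.
have CE : Ck k P (Egrad f).
  by apply: Ck_Egrad => //; apply: Ck_sub (f_smooth _) => S [].
have CG : Ck k P (fun S => Egrad f S ⊙ S) by exact: Ck_hmul.
have Cmarg : Ck k P (fun S => margins pi (Egrad f S ⊙ S)).
  apply: Ck_col_mx => //; apply: Ck_mulmx => //; try exact: Ck_cst.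
  exact: Ck_tr.
have Cdiagc (F : 'M[R]_n -> 'cV[R]_n) :
    Ck k P F -> Ck k P (fun S => diagc (F S)).
  by move=> CF; apply: Ck_diag => //; exact: Ck_tr.
have CSD : Ck k P (fun S : 'M[R]_n => S^T *m diagc pi).
  by apply: Ck_mulmx => //; [exact: Ck_tr | exact: Ck_cst].
have Cgauged : Ck k P (gauged_mx pi).
  apply: CkD => //; last exact: Ck_cst.
  apply: Ck_col_mx => //; apply: Ck_row_mx => //.
  - by apply/Cdiagc/Ck_mulmx => //; exact: Ck_cst.
  - by apply: Ck_mulmx => //; exact: Ck_cst.
  - by apply/Cdiagc/Ck_mulmx => //; exact: Ck_cst.
have Cmult : Ck k P (fun S => multipliers pi S (Egrad f S ⊙ S)).
  apply: Ck_mulmx => //; apply: Ck_invmx => // S [_ S0].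
  exact: gauged_mx_unit.
apply: Ck_mxB => //; apply: Ck_hmul => //; apply: CkD => //.
  apply: Ck_mulmx => //; last exact: Ck_cst.
  apply: (Ck_eq Popen) (Ck_mxsub Popen (lshift n) id Cmult) => S _.
  by rewrite usubmxEsub.
apply: Ck_mulmx => //; first exact: Ck_cst.
apply: Ck_tr => //.
apply: (Ck_eq Popen) (Ck_mxsub Popen (@rshift n n) id Cmult) => S _.
by rewrite dsubmxEsub.
Qed.

Hypothesis stoch_Omega : stoch pi `<=` Omega.

Let stoch_P S : stoch pi S -> P S.
Proof. by move=> hS; split; [exact: stoch_Omega | case: hS]. Qed.

Lemma smooth_field_Rgrad : smooth_field pi (Rgrad pi f).
Proof.
split=> [S /stoch_P/Rgrad_tangent//|].
by exists P, (Rgrad pi f); split=> //; exact: Rgrad_smooth.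
Qed.

Lemma derivable_Rgrad S xi : P S -> derivable (Rgrad pi f) S xi.
Proof.
by move=> PS; have [dG _] := Rgrad_smooth 1; exact/diff_derivable/dG.
Qed.

Lemma derive_Rgrad_tangent S xi : P S -> tangent pi ('D_xi (Rgrad pi f) S).
Proof.
move=> PS; have TR : \forall Z \near S, tangent pi (Rgrad pi f Z).
  by near=> Z; apply: Rgrad_tangent; near: Z; exact: open_nbhs_nbhs.
exact: tangent_derive TR (derivableP (@derivable_Rgrad S xi PS)).
Unshelve. all: by end_near. Qed.

(** The derivative along [xi] of the identity <grad f, eta> = D_eta f, for a
fixed tangent vector [eta]. *)
Lemma fisher_derive_Rgrad S xi eta : P S -> tangent pi eta ->
  fisher S ('D_xi (Rgrad pi f) S - (Rgrad pi f S ⊙ xi) ⊘ S) eta =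
  frob eta (Ehess f S xi).
Proof.
move=> PS heta; have [OS S0] := PS.
have [df _] := f_smooth 1.
have dG := is_derive_fisher eta S0 (derivableP (@derivable_Rgrad S xi PS)).
have dE : derivable (Egrad f) S xi.
  have [dE _] := Ck_Egrad Omega_open (f_smooth 2).
  exact/diff_derivable/dE.
have dF := is_derive_frob eta (derivableP dE).
rewrite -(@derive_val _ _ _ _ _ _ _ dG) -(@derive_val _ _ _ _ _ _ _ dF).
apply: near_eq_derive; near=> Z.
have PZ : P Z by near: Z; exact: open_nbhs_nbhs.
have [OZ Z0] := PZ.
rewrite Rgrad_fproj // dual_proj_fisher // fisher_hmul // /frob.
by rewrite -mxtrace_tr trmx_mul trmxK.
Unshelve. all: by end_near. Qed.

Lemma derive_RgradE S xi a b ad bd : P S -> tangent pi xi ->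
  margins_mx pi S *m col_mx a b = margins pi (Egrad f S ⊙ S) ->
  margins_mx pi S *m col_mx ad bd =
    margins pi (Ehess f S xi ⊙ S + Egrad f S ⊙ xi)
    - margins_mx pi xi *m col_mx a b ->
  'D_xi (Rgrad pi f) S = Ehess f S xi ⊙ S + Egrad f S ⊙ xi
    - dual pi ad bd ⊙ S - dual pi a b ⊙ xi.
Proof.
move=> PS hxi hab hdot; have [OS S0] := PS.
have RE : Rgrad pi f S = Egrad f S ⊙ S - dual pi a b ⊙ S.
  apply: is_gradient_fisher_uniq => //; split=> [|X TX].
    exact: dual_proj_tangent.
  have [df _] := f_smooth 1.
  by rewrite dual_proj_fisher // fisher_hmul // frob_Egrad //; exact: df.
apply: (fisher_tangent_inj S0 (derive_Rgrad_tangent xi PS)) => [|eta heta].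
  apply/tangent_margins; rewrite !marginsB !margins_dual hdot.
  by rewrite subKr subrr.
have := fisher_derive_Rgrad xi PS heta.
have -> : (Rgrad pi f S ⊙ xi) ⊘ S = Egrad f S ⊙ xi - dual pi a b ⊙ xi.
  apply/matrixP => i j; rewrite RE; move: (S0 i j) => Sij0.
  by rewrite !mxE -!mulrBl mulrAC mulfK ?gt_eqF.
rewrite !fisherBl fisherDl !fisher_hmul //.
rewrite frob_dual_tangent // [frob eta _]frobE [frob (Ehess _ _ _) _]frobE.
under eq_bigr do under eq_bigr do rewrite mulrC.
by move=> <-; ring.
Qed.

End RiemannianGradient.

(** * The Riemannian Hessian *)

Unset Implicit Arguments.

Theorem theorem4p6 (R : realType) (n : nat) (pi : 'cV[R]_n)
    (pi_gt0 : forall i, 0 < pi i 0) (pi_sum1 : pi^T *m ones = 1%:M)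
    (nabla : 'M[R]_n -> 'M[R]_n -> ('M[R]_n -> 'M[R]_n) -> 'M[R]_n)
    (nablaP : levi_civita pi nabla)
    (f : 'M[R]_n -> R) (Omega : set 'M[R]_n)
    (Omega_open : open Omega) (stoch_Omega : stoch pi `<=` Omega)
    (f_smooth : smooth_on Omega f)
    (S xi : 'M[R]_n) (hS : stoch pi S) (hxi : tangent pi xi) :
  let gamma : 'M[R]_n := Egrad f S ⊙ S in
  let gammadot : 'M[R]_n := Ehess f S xi ⊙ S + Egrad f S ⊙ xi in
  let A : 'M[R]_(n + n) :=
    block_mx 1%:M (diagc pi *m S)
             (S^T *m diagc pi) (diagc (S^T *m diagc pi *m pi)) in
  let Adot : 'M[R]_(n + n) :=
    block_mx 0 (diagc pi *m xi)
             (xi^T *m diagc pi) (diagc (xi^T *m diagc pi *m pi)) in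
  let alpha_beta_system (alpha beta : 'cV[R]_n) : Prop :=
    A *m col_mx alpha beta = col_mx (gamma *m ones) (gamma^T *m pi) in
  let dot_system (alpha beta alphadot betadot : 'cV[R]_n) : Prop :=
    A *m col_mx alphadot betadot =
      col_mx (gammadot *m ones) (gammadot^T *m pi)
      - Adot *m col_mx alpha beta in
  [/\ Rhess pi nabla f S xi =
        tproj pi S ('D_xi (Rgrad pi f) S)
        - 2^-1 *: tproj pi S ((tproj pi S (Egrad f S ⊙ S) ⊙ xi) ⊘ S),
      exists alpha beta, alpha_beta_system alpha beta,
      forall alpha beta, alpha_beta_system alpha beta ->
        exists alphadot betadot, dot_system alpha beta alphadot betadot &
      forall alpha beta alphadot betadot,
        alpha_beta_system alpha beta ->
        dot_system alpha beta alphadot betadot ->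
        is_derive S xi (Rgrad pi f)
          (gammadot
           - (alphadot *m ones^T + pi *m betadot^T) ⊙ S
           - (alpha *m ones^T + pi *m beta^T) ⊙ xi)].
Proof.
move=> gamma gammadot A Adot alpha_beta_system dot_system.
have [S1 _ S0] := hS; have [xi1 _] := hxi.
have PS : (Omega `&` [set S | forall i j, 0 < S i j]) S.
  by split; first exact: stoch_Omega.
have AE : A = margins_mx pi S.
  rewrite /margins_mx S1 (_ : diagc ones = 1%:M) //.
  by rewrite /diagc trmx_const diag_const_mx.
have AdotE : Adot = margins_mx pi xi.
  by rewrite /margins_mx xi1 (_ : diagc 0 = 0) // /diagc trmx0 linear0.
split.
- rewrite /Rhess (levi_civita_fisher nablaP) //.
  + rewrite (Rgrad_fproj pi_gt0 pi_sum1 f_smooth PS).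
    by rewrite tprojB // tprojZ // (@tproj_fproj _ _ pi pi_gt0 pi_sum1 S gamma).
  + exact: (smooth_field_Rgrad pi_gt0 pi_sum1 Omega_open f_smooth stoch_Omega).
  + exact: (derivable_Rgrad pi_gt0 pi_sum1 Omega_open f_smooth PS).
  + exact: (derive_Rgrad_tangent pi_gt0 pi_sum1 Omega_open f_smooth xi PS).
- exists (usubmx (multipliers pi S gamma)), (dsubmx (multipliers pi S gamma)).
  by rewrite /alpha_beta_system vsubmxK AE multipliersP.
- move=> a b _; pose X := gammadot - dual pi a b ⊙ xi.
  exists (usubmx (multipliers pi S X)), (dsubmx (multipliers pi S X)).
  by rewrite /dot_system vsubmxK AE AdotE multipliersP // marginsB margins_dual.
- move=> a b ad bd; rewrite /alpha_beta_system /dot_system AE AdotE => hab hdot.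
  rewrite -/(dual pi ad bd) -/(dual pi a b).
  rewrite -(derive_RgradE pi_gt0 pi_sum1 Omega_open f_smooth PS hxi hab hdot).
  apply: derivableP.
  exact: (derivable_Rgrad pi_gt0 pi_sum1 Omega_open f_smooth PS).
Qed.
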